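(* Let $\alpha\in[0,1]$. Let $G_1$ be a $t_1$-regular graph of order $n_1$ and size $m_1$, and let $G_2$ be a $t_2$-regular graph of order $n_2$. (a) When $t_1=1$, the $A_\alpha$-spectrum of $G_1\underline\vee_T G_2$ comprises: (i) one simple eigenvalue $3\alpha-1$; (ii) the eigenvalues $\alpha+\lambda_j(A_\alpha(G_2))$ for $j=2,3,\ldots,n_2$; and (iii) three eigenvalues obtained by solving $$(\nu-\alpha -1)(\nu-\alpha -t_2)(\nu-2\alpha -\alpha n_2) -n_2(1-\alpha)^2(\nu-\alpha -1) -2(1-\alpha)^2(\nu-\alpha -t_2)=0.$$ (b) When $t_1\ge2$, the $A_\alpha$-spectrum of $G_1\underline\vee_T G_2$ comprises: (i) one eigenvalue $\alpha(2t_1+2+n_2)-2$ with multiplicity $m_1-n_1$; (ii) the eigenvalues $\alpha m_1+\lambda_j(A_\alpha(G_2))$ for $j=2,3,\ldots,n_2$; (iii) the eigenvalues obtained by solving, for each $i=2,3,\ldots,n_1$, the equation $$\begin{aligned}&\nu^2 -\big(\alpha(t_1 +n_2 +2) +t_1 -2 +2\lambda_i(A_{\alpha}(G_1))\big)\nu -t_1(1-\alpha)(1-3\alpha)\\ &+ \big( \alpha t_1 + \lambda_i(A_\alpha(G_1))\big)\big(t_1 -3 +3\alpha +\alpha n_2 +\lambda_i(A_\alpha(G_1)) \big)=0;\end{aligned}$$ and (iv) three eigenvalues obtained by solving the equation $$(\nu-t_2 -\alpha m_1)(\nu- t_1 -\alpha t_1)(\nu+2 -2t_1-2\alpha -\alpha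 n_2) -\tfrac{1}{2}t_1 n_1 n_2 (1-\alpha)^2(\nu-\alpha t_1 -t_1) -2t_1(1-\alpha)^2(\nu -t_2-\alpha m_1)=0.$$
   Context: All graphs are undirected and simple. For a graph $G$ with adjacency matrix $A(G)$ and diagonal degree matrix $D(G)$, put $A_\alpha(G)=\alpha D(G)+(1-\alpha)A(G)$. The $A_\alpha$-spectrum of $G$ is the multiset of eigenvalues of $A_\alpha(G)$. Eigenvalues of a symmetric $n\times n$ matrix $M$ are ordered $\lambda_1(M)\ge\cdots\ge\lambda_n(M)$. The order of a graph is its number of vertices and its size is its number of edges. The total graph $T(G)$ is obtained from $G$ (keeping all its vertices and edges) by adding one new vertex for every edge of $G$, making each new vertex adjacent to the two end vertices of the corresponding edge, and making two new vertices adjacent whenever their corresponding (distinct) edges share an endpoint in $G$. The $T$-edge join $G_1\underline\vee_T G_2$ is obtained from the disjoint union of $T(G_1)$ and $G_2$ by joining each newly added vertex of $T(G_1)$ to every vertex of $G_2$.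
   Formalization: Part (a) is proved for connected G_1 (so G_1=K_2): for G_1=kK_2, k≥2, the join has 3k+n_2 eigenvalues but (i)–(iii) list only n_2+3. ''Simple'' means one entry of the multiset, since 3α−1 may recur in (ii). Graphs are nonempty. *)

(* Defs.v *)
From HB Require Import structures.
From mathcomp Require Export all_boot all_order all_algebra.
From mathcomp Require Export polyrcf.

Set Implicit Arguments.
Unset Strict Implicit.
Unset Printing Implicit Defensive.

Import Order.TTheory GRing.Theory Num.Theory.
Local Open Scope ring_scope.

Record sgraph := SGraph {
  vertex :> finType;
  adj : rel vertex;
  adj_sym : symmetric adj;
  adj_irrefl : irreflexive adj }.

Section Graph.
Variable G : sgraph.

Definition gorder : nat := #|vertex G|.

(* An edge is the two-element set of its end vertices. *)
Definition edges : {set {set G}} :=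
  [set e : {set G} | [exists x, exists y, adj x y && (e == [set x; y])]].

Definition gsize : nat := #|edges|.

Definition degree (x : G) : nat := #|[set y | adj x y]|.

Definition regular (t : nat) : Prop := forall x : G, degree x = t.

Definition connected : Prop := forall x y : G, connect (@adj G) x y.

Definition edge : finType := {e : {set G} | e \in edges}.

End Graph.

Section TotalGraph.
Variable G : sgraph.

Definition total_adj (u v : G + edge G) : bool :=
  match u, v with
  | inl x, inl y => adj x y
  | inl x, inr e | inr e, inl x => x \in val e
  | inr e, inr f => (e != f) && (val e :&: val f != set0)
  end.

Fact total_adj_sym : symmetric total_adj.
Proof.
by case=> [x|e] [y|f] //=; [exact: adj_sym | rewrite eq_sym setIC].
Qed.

Fact total_adj_irrefl : irreflexive total_adj.
Proof. by case=> [x|e] /=; [exact: adj_irrefl | rewrite eqxx]. Qed.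

Definition total_graph : sgraph := SGraph total_adj_sym total_adj_irrefl.

End TotalGraph.

Section TEdgeJoin.
Variables G1 G2 : sgraph.

Definition added (a : total_graph G1) : bool :=
  if a is inr _ then true else false.

Definition tjoin_adj (u v : total_graph G1 + G2) : bool :=
  match u, v with
  | inl a, inl b => adj a b
  | inr x, inr y => adj x y
  | inl a, inr _ | inr _, inl a => added a
  end.

Fact tjoin_adj_sym : symmetric tjoin_adj.
Proof. by case=> [a|x] [b|y] //; apply: adj_sym. Qed.

Fact tjoin_adj_irrefl : irreflexive tjoin_adj.
Proof. by case=> [a|x]; apply: adj_irrefl. Qed.

Definition tedge_join : sgraph := SGraph tjoin_adj_sym tjoin_adj_irrefl.

End TEdgeJoin.

Section Matrices.
Variables (R : rcfType) (G : sgraph).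

(* Rows and columns are indexed by the vertices through [enum_val]. *)
Definition adj_mx : 'M[R]_(gorder G) :=
  \matrix_(i, j) (adj (enum_val i : G) (enum_val j : G))%:R.

Definition deg_mx : 'M[R]_(gorder G) :=
  diag_mx (\row_i (degree (enum_val i : G))%:R).

Definition Aalpha (alpha : R) : 'M[R]_(gorder G) :=
  alpha *: deg_mx + (1 - alpha) *: adj_mx.

End Matrices.

Section Spectrum.
Variable R : rcfType.

(* The roots of [p] in [R], each repeated according to its multiplicity;
   [rootsR p] lists the distinct ones. *)
Definition proots (p : {poly R}) : seq R :=
  flatten [seq nseq (mup x p) x | x <- rootsR p].

Definition spectrum n (M : 'M[R]_n) : seq R :=
  sort (fun x y => y <= x) (proots (char_poly M)).

(* The [i]-th largest eigenvalue, counted with multiplicity, with [i] starting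
   at 1. *)
Definition lambda n (i : nat) (M : 'M[R]_n) : R := (spectrum M)`_(i.-1).

End Spectrum.

(* Main.v *)
(* Restricted to the added vertices, the join sees G2 through an all-ones block
   and V(G1) through the incidence matrix B of G1, where B B^T = A(G1) + t1 and
   B^T B = A(line graph) + 2.  For x outside a finite set, det(x - A_alpha) is
   computed by two Schur complements (eliminating V(G2), then V(G1)), Sylvester's
   identity, which trades the m1 x m1 determinant for an n1 x n1 one and produces
   the factor (x - c)^(m1 - n1), and a rank-one update for the all-ones part.
   What is left is the determinant of a quadratic polynomial in A_alpha(G1), which
   splits over the spectrum of G1; the eigenvalues t1 and t2 of the constant
   vectors merge into the cubic.  The characteristic polynomial is thus known up
   to powers of x - c, which also covers m1 < n1 (case t1 = 1). *)
Require Import Defs.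
From mathcomp Require Import perm spectral complex mxpoly ring zify.
Import Order.TTheory GRing.Theory Num.Theory.
Local Open Scope ring_scope.

Set Implicit Arguments.
Unset Strict Implicit.
Unset Printing Implicit Defensive.

(* Unlike [hornerE], this keeps the terms readable by [ring]. *)
Local Notation horner_ringE :=
  (hornerD, hornerN, hornerM, hornerZ, hornerXn, hornerX, hornerC).

(** * Multiset of roots of a polynomial *)

Section Roots.
Variable R : rcfType.
Implicit Types (p q : {poly R}) (s : seq R).

(** This turns every permutation statement about lists of roots into an identity between
    multiplicities [mup]. *)
Lemma count_proots p x : p != 0 -> count_mem x (proots p) = mup x p.
Proof.
move=> p0; rewrite /proots count_flatten -map_comp.
rewrite (eq_map (g := fun y => (x == y) * mup y p)%N); last first.
  by move=> y /=; rewrite count_nseq /= eq_sym.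
have [rx|nrx] := boolP (x \in rootsR p).
  rewrite sumnE big_map (bigD1_seq x) //= ?eqxx ?mul1n; last exact: uniq_roots.
  by rewrite big1 ?addn0 // => y /negPf; rewrite eq_sym => ->.
rewrite sumnE big_map big1_seq => [|y /= yr]; last first.
  by case: eqP nrx => // ->; rewrite yr.
apply/esym/mupNroot; apply: contra nrx => rpx.
by rewrite -roots_on_rootsR // rpx inE.
Qed.

Lemma proots_mul p q : p != 0 -> q != 0 ->
  perm_eq (proots (p * q)) (proots p ++ proots q).
Proof.
move=> p0 q0; apply/allP => x _ /=; apply/eqP.
by rewrite count_cat !count_proots ?mulf_neq0 // mupM.
Qed.

Lemma proots_XsubC (a : R) : proots ('X - a%:P) = [:: a].
Proof.
apply/perm_small_eq => //; apply/allP => x _ /=; apply/eqP.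
by rewrite count_proots ?polyXsubC_eq0 // -['X - _]expr1 mup_XsubCX addn0; case: eqP.
Qed.

Lemma proots_exp_XsubC (a : R) n : perm_eq (proots (('X - a%:P) ^+ n)) (nseq n a).
Proof.
apply/allP => x _ /=; apply/eqP.
rewrite count_proots ?expf_neq0 ?polyXsubC_eq0 // mup_XsubCX count_nseq /=.
by case: eqP => _; rewrite ?mul1n ?mul0n.
Qed.

Lemma proots_prod (I : Type) (r : seq I) (F : I -> {poly R}) :
  (forall i, F i != 0) ->
  perm_eq (proots (\prod_(i <- r) F i)) (flatten [seq proots (F i) | i <- r]).
Proof.
move=> F0; elim: r => [|i r IHr] /=.
  by rewrite big_nil /proots rootsRC.
have r0 : \prod_(i <- r) F i != 0.
  by elim/big_ind: _ => *; rewrite ?oner_eq0 ?mulf_neq0.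
by rewrite big_cons (permPl (proots_mul (F0 i) r0)) perm_cat2l.
Qed.

Lemma proots_prod_XsubC s : perm_eq (proots (\prod_(x <- s) ('X - x%:P))) s.
Proof.
have X0 (x : R) : 'X - x%:P != 0 by rewrite polyXsubC_eq0.
rewrite (permPl (proots_prod s X0)).
by elim: s => //= x s IHs; rewrite proots_XsubC perm_cons.
Qed.

(** The product of [p - q] and [d] vanishes everywhere, in particular at more natural numbers than
    its degree allows, and these are distinct in characteristic 0. The polynomial [d] collects the
    points where a pointwise argument breaks down; with [d = 1] the lemma checks polynomial
    identities on values. *)
Lemma eq_poly_cofinite p q d : d != 0 ->
  (forall x, d.[x] != 0 -> p.[x] = q.[x]) -> p = q.
Proof.
move=> d0 pq; apply/eqP; rewrite -subr_eq0 -(mulIr_eq0 _ (mulIf d0)).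
set g := _ * d; apply: contraT => g0.
pose rs : seq R := [seq k%:R | k <- iota 0 (size g)].
have /(max_poly_roots g0) : all (root g) rs.
  apply/allP => x _; rewrite /root /g hornerM.
  have [->|/pq e] := eqVneq d.[x] 0; first by rewrite mulr0.
  by rewrite hornerD hornerN e subrr mul0r.
rewrite map_inj_uniq ?iota_uniq => [/(_ isT)|]; last exact/mulrIn/oner_neq0.
by rewrite size_map size_iota ltnn.
Qed.

End Roots.

(** * Spectra of real symmetric matrices *)

Section Symmetric.
Variable R : rcfType.

(** Over the complex extension [A] is Hermitian, hence diagonalizable with real eigenvalues. Its
    minimal polynomial there divides a product of distinct real linear factors. Minimal polynomials
    are preserved by field extension, so this divisibility descends to [R] and gives
    diagonalizability over [R]. *)
Lemma symmetric_diagonalizable n (A : 'M[R]_n) : A^T = A ->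
  exists P : 'M[R]_n, exists2 d : 'rV[R]_n,
    P \in unitmx & A = invmx P *m diag_mx d *m P.
Proof.
case: n A => [|n] A sA.
  by exists 1%:M, 0; rewrite ?unitmx1 // [LHS]flatmx0 [RHS]flatmx0.
suff /diagonalizableP[P Pu /(diagonalizable_forLR Pu)[d ->]] :
    exists2 rs : seq R, uniq rs & mxminpoly A %| \prod_(x <- rs) ('X - x%:P).
  by exists P, d => //; rewrite conjumx ?unitmx_inv // invmxK.
pose f := real_complex R; pose B := map_mx f A.
have Bherm : B \is hermsymmx.
  apply: realsym_hermsym.
    by apply/is_hermitianmxP; rewrite expr0 scale1r map_mx_id // /B map_trmx sA.
  by apply/mxOverP => i j; rewrite mxE; apply/complex_realP; exists (A i j).
have Breal := hermitian_spectral_diag_real Bherm.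
have /orthomx_spectralP eB := hermitian_normalmx Bherm.
pose e : 'rV[R]_n.+1 := map_mx (@complex.Re R) (spectral_diag B).
have eE : spectral_diag B = map_mx f e.
  by apply/matrixP => i j; rewrite !mxE [RHS]RRe_real //; apply: (mxOverP Breal).
have Pu := spectral_unit B.
(* The distinct eigenvalues, taken as real parts of the complex spectrum. *)
exists (undup [seq e 0 i | i <- enum 'I_n.+1]); first exact: undup_uniq.
rewrite -(dvdp_map f) -mxminpoly_map -/B.
have Bdiag : diagonalizable_for (spectralmx B) B.
  apply/(diagonalizable_forLR Pu); exists (spectral_diag B).
  by rewrite conjumx ?unitmx_inv // invmxK.
have eC : [seq conjmx (spectralmx B) B i i | i <- enum 'I_n.+1]
    = map f [seq e 0 i | i <- enum 'I_n.+1].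
  rewrite -[RHS]map_comp; apply: eq_map => i /=.
  rewrite conjumx // [X in _ *m X *m _]eB !mulmxA mulmxV // mul1mx mulmxK // eE.
  by rewrite !mxE eqxx.
rewrite (diagonalizable_for_mxminpoly Pu Bdiag) eC (undup_map_inj (fmorph_inj f)).
rewrite big_map rmorph_prod.
by under [X in _ %| X]eq_bigr do rewrite /= map_polyXsubC.
Qed.

Lemma horner_char_poly n (A : 'M[R]_n) x : (char_poly A).[x] = \det (x%:M - A).
Proof.
rewrite -[LHS]/(horner_eval x _) -det_map_mx; congr (\det _).
by apply/matrixP => i j; rewrite !mxE /= /horner_eval !hornerE hornerMn hornerX.
Qed.

Lemma char_poly_diag_conj n (P : 'M[R]_n) d : P \in unitmx ->
  char_poly (invmx P *m diag_mx d *m P) = \prod_i ('X - (d 0 i)%:P).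
Proof.
move=> Pu; apply: (@eq_poly_cofinite _ _ _ 1) => [|x _]; first exact: oner_neq0.
rewrite horner_char_poly horner_prod.
have -> : x%:M - invmx P *m diag_mx d *m P
    = invmx P *m (x%:M - diag_mx d) *m P.
  by rewrite mulmxBr mulmxBl mul_mx_scalar -scalemxAl mulVmx // scalemx1.
rewrite !det_mulmx mulrC mulrA -det_mulmx mulmxV // det1 mul1r.
rewrite -diag_const_mx -raddfB /= det_diag.
by apply: eq_bigr => i _; rewrite !mxE !hornerE.
Qed.

Lemma perm_spectrum_diag n (P : 'M[R]_n) d : P \in unitmx ->
  perm_eq (spectrum (invmx P *m diag_mx d *m P)) [seq d 0 i | i <- enum 'I_n].
Proof.
move=> Pu; rewrite /spectrum perm_sort char_poly_diag_conj //.
by rewrite -big_enum -(big_map (d 0) xpredT (fun x => 'X - x%:P)) proots_prod_XsubC.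
Qed.

Lemma symmetric_char_poly n (A : 'M[R]_n) : A^T = A ->
  char_poly A = \prod_(x <- spectrum A) ('X - x%:P).
Proof.
case/symmetric_diagonalizable => P [d Pu ->].
rewrite (perm_big _ (perm_spectrum_diag _ Pu)) /= big_map big_enum /=.
exact: char_poly_diag_conj.
Qed.

Lemma size_spectrum n (A : 'M[R]_n) : A^T = A -> size (spectrum A) = n.
Proof.
case/symmetric_diagonalizable => P [d Pu ->].
by rewrite (perm_size (perm_spectrum_diag _ Pu)) size_map size_enum_ord.
Qed.

(** Both sides are, up to sign, the coefficient of degree [n.-1] of the characteristic
    polynomial. *)
Lemma sum_spectrum n (A : 'M[R]_n) : (0 < n)%N -> A^T = A ->
  \sum_(x <- spectrum A) x = \tr A.
Proof.
move=> n0 sA; apply: oppr_inj; rewrite -char_poly_trace // symmetric_char_poly //.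
by rewrite -coefPn_prod_XsubC size_spectrum // -lt0n.
Qed.

Lemma symmetric_det_quadratic n (A : 'M[R]_n) a b c : A^T = A ->
  \det (a%:M + b *: A + c *: (A *m A))
    = \prod_(x <- spectrum A) (a + b * x + c * x ^+ 2).
Proof.
case/symmetric_diagonalizable => P [d Pu ->].
rewrite (perm_big _ (perm_spectrum_diag _ Pu)) /= big_map big_enum /=.
set D := diag_mx d.
have -> : a%:M + b *: (invmx P *m D *m P)
      + c *: (invmx P *m D *m P *m (invmx P *m D *m P))
    = invmx P *m (a%:M + b *: D + c *: (D *m D)) *m P.
  rewrite !mulmxDr !mulmxDl mul_mx_scalar -!scalemxAr -!scalemxAl mulVmx //.
  by rewrite scalemx1 !mulmxA mulmxK.
rewrite !det_mulmx mulrC mulrA -det_mulmx mulmxV // det1 mul1r.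
have -> : a%:M + b *: D + c *: (D *m D)
    = diag_mx (\row_i (a + b * d 0 i + c * d 0 i ^+ 2)).
  apply/matrixP => i j; rewrite mulmx_diag !mxE.
  by case: eqP => _; rewrite ?mulr1n // !mulr0n !mulr0 !addr0.
by rewrite det_diag; apply: eq_bigr => i _; rewrite mxE.
Qed.

(** Read the eigenvector equation at a coordinate [j] of largest modulus: the triangle inequality
    bounds [a] by the sum of column [j], which by symmetry is the row sum [t]. *)
Lemma root_char_poly_le n (A : 'M[R]_n) t a : A^T = A ->
  (forall i j, 0 <= A i j) -> (forall i, \sum_j A i j = t) ->
  root (char_poly A) a -> a <= t.
Proof.
move=> sA A0 rowA; rewrite -eigenvalue_root_char => /eigenvalueP[v vA v0].
have [k vk0] : exists k, v 0 k != 0 by apply/rV0Pn.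
pose j := [arg max_(i > k) `|v 0 i|]%O.
have jmax i : `|v 0 i| <= `|v 0 j|.
  by rewrite /j; case: Order.TotalTheory.arg_maxP => // i0 _ m; apply: m.
have vj : 0 < `|v 0 j| by apply: lt_le_trans (jmax k); rewrite normr_gt0.
apply: le_trans (ler_norm a) _.
rewrite -(ler_pM2r vj) -normrM.
have -> : a * v 0 j = \sum_i v 0 i * A i j.
  by have /matrixP/(_ 0 j) := vA; rewrite !mxE => <-.
apply: le_trans (ler_norm_sum _ _ _) _.
rewrite -(rowA j) mulr_suml; apply: ler_sum => i _.
have -> : A j i = A i j by rewrite -{1}sA mxE.
by rewrite normrM mulrC (ger0_norm (A0 _ _)) ler_wpM2l.
Qed.

(** The all-ones vector has eigenvalue [t], and no eigenvalue exceeds the row sum, so [t] heads the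
    sorted list. *)
Lemma spectrum_cons n (A : 'M[R]_n) t : (0 < n)%N -> A^T = A ->
  (forall i j, 0 <= A i j) -> (forall i, \sum_j A i j = t) ->
  spectrum A = t :: [seq lambda j A | j <- index_iota 2 n.+1].
Proof.
move=> n0 sA A0 rowA.
have rootE x : root (char_poly A) x = (x \in spectrum A).
  by rewrite symmetric_char_poly // root_prod_XsubC.
have tA : t \in spectrum A.
  rewrite -rootE -eigenvalue_root_char; apply/eigenvalueP.
  exists (const_mx 1).
    apply/rowP => j; rewrite !mxE mulr1 -(rowA j); apply: eq_bigr => i _.
    by rewrite mxE mul1r -{1}sA mxE.
  by apply/rV0Pn; exists (Ordinal n0); rewrite mxE oner_neq0.
have szA := size_spectrum sA.
have srtA : sorted >=%R (spectrum A) by apply: sort_sorted => x y; exact: le_total.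
have leA x : x \in spectrum A -> x <= t.
  by rewrite -rootE; apply: root_char_poly_le.
(* [lambda j] reads position [j.-1], so the indices 2 to [n] are exactly the positions after the
   head. *)
have -> : [seq lambda j A | j <- index_iota 2 n.+1] = behead (spectrum A).
  apply: (@eq_from_nth _ 0); rewrite size_map size_iota subSS subn1.
    by rewrite size_behead szA.
  move=> i ilt; rewrite (nth_map 0%N) ?size_iota ?subSS ?subn1 //.
  by rewrite nth_iota ?subSS ?subn1 // nth_behead.
case: (spectrum A) tA srtA leA => //= x s; rewrite inE => tA srtA leA.
congr (_ :: _); apply/le_anti; rewrite leA ?mem_head //=.
case/predU1P: tA => [->//|ts].
by move/(order_path_min (rev_trans le_trans))/allP: srtA; apply.
Qed.

End Symmetric.

(** * Block determinants *)

Section Determinants.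
Variable F : fieldType.

Lemma det_schur_ul n m (A : 'M[F]_n) (B : 'M_(n, m)) (C : 'M_(m, n)) (D : 'M_m) :
  A \in unitmx ->
  \det (block_mx A B C D) = \det A * \det (D - C *m invmx A *m B).
Proof.
move=> Au.
have -> : block_mx A B C D
    = block_mx 1%:M 0 (C *m invmx A) 1%:M *m block_mx A B 0 (D - C *m invmx A *m B).
  by rewrite mulmx_block !mul1mx !mul0mx ?mulmx0 !addr0 mulmxKV // addrC subrK.
by rewrite det_mulmx det_lblock det_ublock !det1 !mul1r.
Qed.

Lemma det_schur_dr n m (A : 'M[F]_n) (B : 'M_(n, m)) (C : 'M_(m, n)) (D : 'M_m) :
  D \in unitmx ->
  \det (block_mx A B C D) = \det D * \det (A - B *m invmx D *m C).
Proof.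
move=> Du.
have -> : block_mx A B C D
    = block_mx 1%:M (B *m invmx D) 0 1%:M *m block_mx (A - B *m invmx D *m C) 0 C D.
  by rewrite mulmx_block !mul1mx !mul0mx ?mulmx0 ?mul0mx ?addr0 ?add0r mulmxKV // subrK.
by rewrite det_mulmx det_lblock det_ublock !det1 !mul1r mulrC.
Qed.

(** Compute the determinant of the block matrix with rows [w, D] and [C, 1] by both Schur
    complements. Keeping a power of [w] on each side avoids an exponent [m - n], which may be
    negative. *)
Lemma det_sylvester n m (C : 'M[F]_(m, n)) (D : 'M_(n, m)) w : w != 0 ->
  w ^+ n * \det (w%:M - C *m D) = w ^+ m * \det (w%:M - D *m C).
Proof.
move=> w0; have wu : (w%:M : 'M_n) \in unitmx.
  by rewrite unitmxE det_scalar unitfE expf_neq0.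
have := @det_schur_dr _ _ w%:M D C 1%:M (unitmx1 _ _).
rewrite det_schur_ul // det1 mul1r invmx1 mulmx1 => <-.
rewrite det_scalar mulrCA; congr (_ * _).
rewrite -[w ^+ m](det_scalar m) -det_mulmx; congr (\det _).
rewrite mul_scalar_mx scalerBr scalemx1 invmx_scalar mul_mx_scalar.
by rewrite -scalemxAl scalerA divff // scale1r.
Qed.

(** Since [e] is an eigenvector, [A] factors out of the rank-one update without being inverted; the
    other factor is reduced to a 1 by 1 determinant by Sylvester's identity. *)
Lemma det_sub_outer n (A : 'M[F]_n) k f (e : 'cV_n) : f != 0 -> A *m e = f *: e ->
  f * \det (A - k *: (e *m e^T)) = \det A * (f - k * (e^T *m e) 0 0).
Proof.
move=> f0 Ae.
have -> : A - k *: (e *m e^T) = A *m (1%:M - (k / f) *: e *m e^T).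
  rewrite mulmxBr mulmx1 -!scalemxAl -scalemxAr mulmxA Ae -scalemxAl scalerA.
  by rewrite divfK.
have := det_sylvester ((k / f) *: e) e^T (oner_neq0 F).
rewrite !expr1n !mul1r det_mulmx => ->.
rewrite det_mx11 -scalemxAr; move: (e^T *m e) => y.
by rewrite !mxE eqxx mulr1n; field.
Qed.

End Determinants.

(** * Determinant of the block matrix of the join *)

Section JoinDeterminant.
Variable R : numFieldType.
Local Notation e := (const_mx 1 : 'cV_(_)).

(** Here [U] and [Q] stand for the blocks of V(G1) and V(G2), [B] for the incidence matrix, and [u],
    [q], [f] are the eigenvalues of [U], [Q], [G] at the all-ones vector. [G] is what the successive
    eliminations leave on V(G1) apart from the rank-one term coming from V(G2), which produces the
    last factor. *)
Lemma det_tedge_join_blocks n m p (U : 'M[R]_n) (B : 'M[R]_(n, m)) (Q : 'M[R]_p)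
    (w b u t q : R) :
  let K := b *: (B *m B^T) in
  let G := w *: U - (U + b%:M) *m K in
  let f := w * u - (u + b) * (2 * b * t) in
  U \in unitmx -> Q \in unitmx -> w != 0 -> q != 0 -> f != 0 ->
  U *m e = u *: e -> Q *m e = q *: e ->
  e^T *m B = 2 *: e^T -> B *m e = t *: e ->
  w ^+ n * (f * q) *
    \det (block_mx
            (block_mx U (- (b *: B)) (- (b *: B^T)) (w%:M - b *: (B^T *m B)))
            (col_mx 0 (- (b *: const_mx 1))) (row_mx 0 (- (b *: const_mx 1))) Q)
  = w ^+ m * \det Q * \det G * (f * q - 2^-1 * n%:R * p%:R * b ^+ 2 * t * u).
Proof.
move=> K G f Uu Qu w0 q0 f0 Ue Qe eB Be.
have eQ : invmx Q *m e = q^-1 *: e.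
  by rewrite -[e in RHS](mulKmx Qu) Qe -scalemxAr scalerA mulVf ?scale1r.
have JE k l : (const_mx 1 : 'M[R]_(k, l)) = e *m e^T.
  by apply/matrixP => i j; rewrite !mxE big_ord1 !mxE mulr1.
have ee k : (e^T *m (e : 'cV[R]_k)) = k%:R%:M.
  apply/matrixP => i j; rewrite !ord1 !mxE.
  under eq_bigr do rewrite !mxE mul1r.
  by rewrite sumr_const card_ord.
have Be2 : B^T *m e = 2 *: e.
  by rewrite -[LHS]trmxK trmx_mul trmxK eB linearZ /= trmxK.
pose s := b ^+ 2 * p%:R / q.
(* Eliminating [Q] adds [s] times the all-ones matrix on the edges. As [B^T *m e = 2 *: e], this
   matrix is a quarter of [B^T *m (e *m e^T) *m B], so the whole correction can be written between
   [B^T] and [B]. *)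
have schurQ : block_mx U (- (b *: B)) (- (b *: B^T)) (w%:M - b *: (B^T *m B))
      - col_mx 0 (- (b *: const_mx 1)) *m invmx Q *m row_mx 0 (- (b *: const_mx 1))
    = block_mx U (- (b *: B)) (- (b *: B^T))
        (w%:M - B^T *m (b%:M + (s / 4) *: (e *m e^T)) *m B).
  rewrite mul_col_mx mul_col_row !mul0mx ?mulmx0 opp_block_mx add_block_mx.
  rewrite !oppr0 !addr0; congr block_mx.
  rewrite -addrA -opprD; congr (_ - _).
  rewrite mulmxDr mulmxDl mul_mx_scalar -scalemxAl; congr (_ + _).
  rewrite mulNmx mulNmx mulmxN opprK (JE m p) (JE p m).
  rewrite -!scalemxAr -!scalemxAl scalerA -!mulmxA (mulmxA (invmx Q)) eQ.
  rewrite -!scalemxAl -!scalemxAr (mulmxA e^T) ee mul_scalar_mx -scalemxAr.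
  rewrite eB -!scalemxAr (mulmxA B^T) Be2 -scalemxAl !scalerA; congr (_ *: _).
  by rewrite /s; field.
rewrite det_schur_dr // schurQ det_schur_ul //.
set N := b%:M + _.
have -> : w%:M - B^T *m N *m B - - (b *: B^T) *m invmx U *m - (b *: B)
    = w%:M - B^T *m ((N + b ^+ 2 *: invmx U) *m B).
  rewrite mulmxDl mulmxDr opprD addrA mulmxA; congr (_ - _).
  by rewrite mulNmx mulNmx mulmxN opprK -!scalemxAl -!scalemxAr !scalerA !mulmxA.
set D := _ *m B.
have -> : w ^+ n * (f * q) * (\det Q * (\det U * \det (w%:M - B^T *m D)))
   = \det Q * q * (f * (\det U * (w ^+ n * \det (w%:M - B^T *m D)))) by ring.
rewrite det_sylvester //.
(* The constant is [s / 4] times [u], from [U] acting on [e], times [2 * t], from [e^T] acting on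
   [B *m B^T]. *)
pose k := s / 2 * t * u.
have GE : U *m (w%:M - D *m B^T) = G - k *: (e *m e^T).
  have eL : e^T *m (B *m B^T) = (2 * t) *: e^T.
    rewrite mulmxA eB -scalemxAl -trmx_mul Be [(t *: e)^T]linearZ /=.
    by rewrite scalerA.
  rewrite mulmxBr mul_mx_scalar /G /K -[in RHS]addrA; congr (_ + _).
  rewrite -opprD; congr (- _).
  have -> : U *m (D *m B^T) = U *m (N + b ^+ 2 *: invmx U) *m (B *m B^T).
    by rewrite /D !mulmxA.
  rewrite mulmxDr /N mulmxDr mul_mx_scalar -!scalemxAr mulmxV // (mulmxA U) Ue.
  rewrite !mulmxDl -!scalemxAl -mulmxA eL mul1mx mul_scalar_mx.
  rewrite -!scalemxAr scalerDr !scalerA addrAC -expr2 /k; congr (_ + _ *: _).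
  by field.
have Ge : G *m e = f *: e.
  have Ke : K *m e = (2 * b * t) *: e.
    rewrite /K -scalemxAl -mulmxA Be2 -scalemxAr Be !scalerA; congr (_ *: _).
    by ring.
  rewrite /G mulmxBl -scalemxAl Ue -mulmxA Ke -scalemxAr mulmxDl Ue mul_scalar_mx.
  by rewrite -scalerDl !scalerA -scalerBl; congr (_ *: _); rewrite /f; ring.
rewrite [\det U * _]mulrCA -det_mulmx GE [f * _]mulrCA (det_sub_outer _ f0 Ge).
rewrite ee mxE eqxx mulr1n /k /s.
by field.
Qed.
End JoinDeterminant.

(** * Counting vertices and edges *)

Lemma sum_mem_set (T : finType) (A : {set T}) : (\sum_x (x \in A))%N = #|A|.
Proof.
by rewrite -sum1_card [RHS]big_mkcond; apply: eq_bigr => x _; case: (_ \in _).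
Qed.

Section EdgeCounting.
Variable G : sgraph.
Implicit Types (x y : G) (e f : edge G).

Lemma degreeE x : degree x = (\sum_y adj x y)%N.
Proof.
by rewrite /degree -sum_mem_set; apply: eq_bigr => y _; rewrite inE.
Qed.

Lemma edgeP e : exists x, exists2 y, adj x y & val e = [set x; y].
Proof.
have := valP e; rewrite inE => /existsP[x /existsP[y /andP[xy /eqP ->]]].
by exists x, y.
Qed.

Lemma adj_neq x y : adj x y -> x != y.
Proof. by apply: contraTneq => ->; rewrite adj_irrefl. Qed.

Lemma card_edge e : #|val e| = 2%N.
Proof. by have [x [y /adj_neq xy ->]] := edgeP e; rewrite cards2 xy. Qed.

Lemma mem_edge2 e x y : x \in val e -> y \in val e -> x != y ->
  adj x y /\ val e = [set x; y].
Proof.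
have [a [b ab ->]] := edgeP e; have := ab; rewrite adj_sym => ba.
by rewrite !inE => /orP[]/eqP-> /orP[]/eqP->; rewrite ?eqxx // setUC.
Qed.

Lemma edge_of_adj x y : adj x y -> exists e, val e = [set x; y].
Proof.
move=> xy; have exy : [set x; y] \in edges G.
  by rewrite inE; apply/existsP; exists x; apply/existsP; exists y; rewrite xy /=.
by exists (exist (fun e : {set G} => e \in edges G) _ exy).
Qed.

(** At most one edge contains two given distinct vertices. These are the off-diagonal entries of
    [B *m B^T], for the incidence matrix [B]. *)
Lemma sum_edge_adj x y : x != y ->
  (\sum_(e : edge G) (x \in val e) * (y \in val e))%N = adj x y.
Proof.
move=> nxy; have [xy|nadj] := boolP (adj x y).
  have [e0 e0E] := edge_of_adj xy.
  rewrite (bigD1 e0) //= e0E !inE !eqxx orbT big1 // => e ne0.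
  apply/eqP; rewrite muln_eq0 !eqb0; apply: contraNT ne0.
  rewrite negb_or !negbK => /andP[xe ye]; apply/eqP/val_inj.
  by rewrite e0E; have [] := mem_edge2 xe ye nxy.
rewrite big1 // => e _; apply/eqP; rewrite muln_eq0 !eqb0; apply: contraNT nadj.
by rewrite negb_or !negbK => /andP[xe ye]; have [] := mem_edge2 xe ye nxy.
Qed.

Lemma sum_edge_mem x : (\sum_(e : edge G) (x \in val e))%N = degree x.
Proof.
(* Double count the pairs (y, e) with e = {x, y}. *)
rewrite degreeE (bigD1 x) //= adj_irrefl add0n.
under [RHS]eq_bigr => y nyx do rewrite -sum_edge_adj 1?eq_sym //.
rewrite exchange_big /=; apply: eq_bigr => e _.
rewrite -big_distrr /=; have [xe|_] := boolP (x \in val e); last by rewrite mul0n.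
by have := sum_mem_set (val e); rewrite card_edge (bigD1 x) //= xe; lia.
Qed.

(** Distinct edges meet in at most one vertex, while an edge meets itself in two. This is the
    entrywise form of [B^T *m B] as line graph adjacency plus 2. *)
Lemma sum_vertex_mem2 e f :
  (\sum_x (x \in val e) * (x \in val f))%N
  = (((e != f) && (val e :&: val f != set0)) + 2 * (e == f))%N.
Proof.
have -> : (\sum_x (x \in val e) * (x \in val f))%N = #|val e :&: val f|.
  rewrite -sum_mem_set; apply: eq_bigr => x _.
  by rewrite inE mulnb.
have [->|nef] /= := eqVneq e f; first by rewrite setIid card_edge.
rewrite addn0 -card_gt0; case: ltnP => [gt0|]; last by rewrite leqn0 => /eqP.
apply/eqP; rewrite eqn_leq gt0 andbT leqNgt; apply: contra nef => /card_gt1P[x [y []]].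
rewrite !inE => /andP[xe xf] /andP[ye yf] nxy; apply/eqP/val_inj.
by have [_ ->] := mem_edge2 xe ye nxy; have [_ ->] := mem_edge2 xf yf nxy.
Qed.

(** Sum the previous identity over [f]: each of the two ends of [e] lies on [t] edges. The summand 2
    stays on the left to avoid truncated subtraction. *)
Lemma sum_edge_line t e : regular G t ->
  (\sum_(f : edge G) ((e != f) && (val e :&: val f != set0)) + 2 = 2 * t)%N.
Proof.
move=> regG.
have -> : (2 * t = \sum_(f : edge G) \sum_x (x \in val e) * (x \in val f))%N.
  rewrite exchange_big /=.
  under eq_bigr => x _ do rewrite -big_distrr /= sum_edge_mem regG.
  by rewrite -big_distrl /= sum_mem_set card_edge.
under [RHS]eq_bigr do rewrite sum_vertex_mem2.
rewrite big_split /= -big_distrr /=.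
suff -> : (\sum_(f : edge G) (e == f) = 1)%N by rewrite muln1.
rewrite (bigD1 e) //= eqxx big1 // => f.
by rewrite eq_sym => /negPf ->.
Qed.

Lemma card_edge_type : #|edge G| = gsize G.
Proof. by rewrite card_sig; apply: eq_card => e; rewrite !inE. Qed.

Lemma handshake t : regular G t -> (2 * gsize G = gorder G * t)%N.
Proof.
move=> regG; have -> : (gorder G * t = \sum_(x : G) \sum_(e : edge G) (x \in val e))%N.
  under eq_bigr => x _ do rewrite sum_edge_mem regG.
  by rewrite sum_nat_const.
rewrite exchange_big /=.
under eq_bigr => e _ do rewrite sum_mem_set card_edge.
by rewrite sum_nat_const card_edge_type mulnC.
Qed.

End EdgeCounting.

(** * The matrix of the join in block form *)

(** Two enumerations of [T] differ by a permutation acting on rows and columns alike, so its sign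
    enters squared. This passes from the [enum_val] order on the vertices of the join to the block
    order. *)
Lemma det_reindex (R : comPzRingType) (T : finType) k1 k2 (h1 : 'I_k1 -> T)
    (h2 : 'I_k2 -> T) (g : T -> T -> R) : bijective h1 -> bijective h2 ->
  \det (\matrix_(i, j) g (h1 i) (h1 j)) = \det (\matrix_(i, j) g (h2 i) (h2 j)).
Proof.
move=> bij1 bij2; have k12 : k1 = k2.
  by rewrite -[k1]card_ord -[k2]card_ord (bij_eq_card bij1) (bij_eq_card bij2).
case: k2 / k12 h2 bij2 => h2 bij2; have [h1' K1 K1'] := bij1.
have inj_s : injective (h1' \o h2).
  by apply: inj_comp; [apply: can_inj K1' | apply: bij_inj].
set M := \matrix_(i, j) g (h1 i) (h1 j).
have -> : \matrix_(i, j) g (h2 i) (h2 j) 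
    = row_perm (perm inj_s) (col_perm (perm inj_s) M).
  by apply/matrixP => i j; rewrite !mxE !permE /= !K1'.
rewrite row_permE col_permE !det_mulmx !det_perm odd_permV.
by rewrite mulrC -mulrA -expr2 sqrr_sign mulr1.
Qed.

Section AalphaMatrix.
Variables (R : rcfType) (G : sgraph) (alpha : R).
Local Notation A := (Aalpha G alpha).

Lemma Aalpha_entry i j :
  A i j = (alpha * (degree (enum_val i : G))%:R) *+ (i == j)
          + (1 - alpha) * (adj (enum_val i : G) (enum_val j))%:R.
Proof. by rewrite !mxE -mulrnAr. Qed.

Lemma Aalpha_sym : A^T = A.
Proof.
apply/matrixP => i j; rewrite mxE !Aalpha_entry eq_sym adj_sym.
by case: eqP => [->|].
Qed.

Lemma Aalpha_ge0 : 0 <= alpha <= 1 -> forall i j, 0 <= A i j.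
Proof.
case/andP=> a0 a1 i j; rewrite Aalpha_entry.
by rewrite addr_ge0 ?mulrn_wge0 ?mulr_ge0 ?subr_ge0.
Qed.

Lemma sum_enum_val (T : finType) (F : T -> R) :
  \sum_(i < #|T|) F (enum_val i) = \sum_x F x.
Proof. by rewrite -(@big_enum_val _ _ _ T T) /=; apply: eq_bigl. Qed.

Lemma Aalpha_row_sum t : regular G t -> forall i, \sum_j A i j = t%:R.
Proof.
move=> regG i; under eq_bigr do rewrite Aalpha_entry.
rewrite big_split /= -big_distrr /= (bigD1 i) //= eqxx big1 => [|j]; last first.
  by rewrite eq_sym => /negPf ->.
rewrite addr0 (sum_enum_val (fun y : G => (adj (enum_val i) y)%:R)).
rewrite -natr_sum -degreeE regG mulr1n; ring.
Qed.

Lemma Aalpha_ones t : regular G t ->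
  A *m const_mx 1 = t%:R *: (const_mx 1 : 'cV_(_)).
Proof.
move=> regG; apply/matrixP => i j; rewrite !mxE mulr1.
rewrite -(Aalpha_row_sum regG i); apply: eq_bigr => k _.
by rewrite [const_mx _ _ _]mxE mulr1.
Qed.

Lemma Aalpha_trace t : regular G t -> \tr A = (gorder G)%:R * (alpha * t%:R).
Proof.
move=> regG; rewrite /mxtrace.
under eq_bigr do rewrite Aalpha_entry eqxx adj_irrefl mulr0 addr0 regG mulr1n.
by rewrite sumr_const card_ord mulr_natl.
Qed.

End AalphaMatrix.

Section TEdgeJoinMatrix.
Variables (R : rcfType) (G1 G2 : sgraph).
Local Notation J := (tedge_join G1 G2).

(** The columns follow the enumeration of the type [edge G1]; its cardinal is identified with
    [gsize G1] by [card_edge_type]. *)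
Definition incidence_mx : 'M[R]_(gorder G1, #|edge G1|) :=
  \matrix_(i, j) ((enum_val i : G1) \in val (enum_val j : edge G1))%:R.

Local Notation B := incidence_mx.
Local Notation ones := (const_mx 1 : 'cV[R]_(_)).


Variables (t1 t2 : nat).
Hypotheses (reg1 : regular G1 t1) (reg2 : regular G2 t2).

Lemma degree_vertex (x : G1) : degree (inl (inl x) : J) = (2 * t1)%N.
Proof.
rewrite degreeE !big_sumType /= [X in (_ + X)%N]big1 // addn0.
by rewrite -degreeE reg1 sum_edge_mem reg1 addnn mul2n.
Qed.

(** An added vertex sees two end vertices, [2 * t1 - 2] adjacent edges and all of [G2]. The 2 on
    both sides matches [sum_edge_line]. *)
Lemma degree_edge (e : edge G1) :
  (degree (inl (inr e) : J) + 2 = 2 * t1 + gorder G2 + 2)%N.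
Proof.
rewrite degreeE !big_sumType /= sum_mem_set card_edge sum1_card.
by rewrite -(sum_edge_line e reg1) (addnC 2%N).
Qed.

Lemma degree_right (y : G2) : degree (inr y : J) = (gsize G1 + t2)%N.
Proof.
rewrite degreeE !big_sumType /= big1 // add0n sum1_card card_edge_type.
by rewrite -degreeE reg2.
Qed.

Lemma incidence_col_sum : ones^T *m B = 2 *: ones^T.
Proof.
apply/matrixP => i j; rewrite !mxE mulr1.
under eq_bigr do rewrite !mxE mul1r.
rewrite (sum_enum_val (fun x : G1 => (x \in val (enum_val j : edge G1))%:R)).
by rewrite -natr_sum sum_mem_set card_edge.
Qed.

Lemma incidence_row_sum : B *m ones = t1%:R *: ones.
Proof.
apply/matrixP => i j; rewrite !mxE mulr1.
under eq_bigr do rewrite !mxE mulr1.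
rewrite (sum_enum_val (fun e : edge G1 => (enum_val i \in val e)%:R)).
by rewrite -natr_sum sum_edge_mem reg1.
Qed.

(** From [B *m B^T] being adjacency plus [t1], where [1 - alpha] times the adjacency matrix is
    [Aalpha] minus [alpha * t1]. *)
Lemma incidence_mul_tr (alpha : R) :
  (1 - alpha) *: (B *m B^T)
  = Aalpha G1 alpha + ((1 - alpha - alpha) * t1%:R)%:M.
Proof.
apply/matrixP => i j; rewrite [in LHS]mxE [in RHS]mxE Aalpha_entry !mxE.
under eq_bigr do rewrite !mxE -natrM.
rewrite (sum_enum_val (fun e : edge G1 =>
  ((enum_val i \in val e) * (enum_val j \in val e))%:R)) -natr_sum.
have [->|nij] := eqVneq i j.
  under eq_bigr do rewrite mulnb andbb.
  rewrite sum_edge_mem adj_irrefl reg1 !mulr1n mulr0n; ring.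
by rewrite sum_edge_adj ?(inj_eq enum_val_inj) // !mulr0n; ring.
Qed.

Lemma incidence_tr_mul i j :
  (B^T *m B) i j
  = ((enum_val i != enum_val j :> edge G1) &&
      (val (enum_val i : edge G1) :&: val (enum_val j : edge G1) != set0))%:R
    + 2 *+ (i == j).
Proof.
rewrite !mxE; under eq_bigr do rewrite !mxE -natrM.
rewrite (sum_enum_val (fun x : G1 =>
  ((x \in val (enum_val i : edge G1)) * (x \in val (enum_val j : edge G1)))%:R)).
rewrite -natr_sum sum_vertex_mem2 natrD (inj_eq enum_val_inj).
by rewrite natrM mulr_natr.
Qed.

(** In the edge block the line graph adjacency is replaced by [B^T *m B] minus 2; the resulting
    [2 * b] accounts for the shift of the scalar from [x - alpha * (2 * t1 + n2)], with [n2] the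
    order of [G2]. *)
Lemma det_tedge_join (alpha x : R) : let b := 1 - alpha in
  (char_poly (Aalpha J alpha)).[x]
  = \det (block_mx
      (block_mx ((x - alpha * t1%:R)%:M - Aalpha G1 alpha) (- (b *: B)) (- (b *: B^T))
         ((x - alpha * (2 * t1%:R + 2 + (gorder G2)%:R) + 2)%:M - b *: (B^T *m B)))
      (col_mx 0 (- (b *: const_mx 1))) (row_mx 0 (- (b *: const_mx 1)))
      ((x - alpha * (gsize G1)%:R)%:M - Aalpha G2 alpha)).
Proof.
move=> b; rewrite horner_char_poly.
have subE k (s : R) (N : 'M_k) i j : (s%:M - N) i j = s *+ (i == j) - N i j.
  by rewrite !mxE.
have scaleE k (s : R) (N : 'M_k) i j : (s *: N) i j = s * N i j by rewrite mxE.
pose g (u v : J) : R := (x - alpha * (degree u)%:R) *+ (u == v) - b * (adj u v)%:R.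
(* The block order: V(G1), then the added vertices, then V(G2). *)
pose h (i : 'I_(gorder G1 + #|edge G1| + gorder G2)) : J :=
  match split i with
  | inl k => inl (match split k with inl i1 => inl (enum_val i1)
                                   | inr i2 => inr (enum_val i2) end)
  | inr k => inr (enum_val k)
  end.
have bij_h : bijective h.
  apply: inj_card_bij; last first.
    by rewrite card_ord !card_sum.
  move=> i j; rewrite -(splitK i) -(splitK j) /h !unsplitK.
  case: (split i) (split j) => [k|k] [l|l] //=; last by case=> /enum_val_inj ->.
  rewrite -(splitK k) -(splitK l) !unsplitK.
  by case: (split k) (split l) => [a|a] [c|c] //= [] /enum_val_inj ->.
have -> : x%:M - Aalpha J alpha = \matrix_(i, j) g (enum_val i) (enum_val j).
  apply/matrixP => i j; rewrite subE Aalpha_entry mxE.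
  by rewrite /g (inj_eq enum_val_inj) opprD addrA mulrnBl.
rewrite (det_reindex g (enum_val_bij _) bij_h); congr (\det _).
have deg_e e : (degree (inl (inr e) : J))%:R = 2 * t1%:R + (gorder G2)%:R :> R.
  by apply: (addIr 2); rewrite -natrD degree_edge natrD natrD natrM.
have inlI (S T : Type) : injective (@inl S T) by move=> ? ? [].
have inrI (S T : Type) : injective (@inr S T) by move=> ? ? [].
apply/matrixP => i j; rewrite mxE /h [RHS]mxE.
case: (split i) => k; rewrite [RHS]mxE; case: (split j) => l.
- rewrite [RHS]mxE; case: (split k) => a; rewrite [RHS]mxE; case: (split l) => c.
  + rewrite /g !(inj_eq (inlI _ _)) (inj_eq enum_val_inj) degree_vertex.
    rewrite subE Aalpha_entry reg1 natrM /=.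
    by rewrite opprD addrA -mulrnBl; congr (_ *+ _ - _); ring.
  + by rewrite /g !mxE /= sub0r.
  + by rewrite /g !mxE /= sub0r.
  + rewrite /g !(inj_eq (inlI _ _)) (inj_eq (inrI _ _)) (inj_eq enum_val_inj) deg_e.
    rewrite subE scaleE incidence_tr_mul /=.
    rewrite (inj_eq enum_val_inj) /b; case: eqP => _ /=; rewrite ?mulr1n ?mulr0n; ring.
- rewrite [RHS]mxE; case: (split k) => a; rewrite /g !mxE /= sub0r.
  + by rewrite mulr0 oppr0.
  + by rewrite mulr1.
- rewrite [RHS]mxE; case: (split l) => a; rewrite /g !mxE /= sub0r.
  + by rewrite mulr0 oppr0.
  + by rewrite mulr1.
- rewrite /g (inj_eq (inrI _ _)) (inj_eq enum_val_inj) degree_right.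
  rewrite subE Aalpha_entry reg2 natrD /=.
  by rewrite opprD addrA -mulrnBl; congr (_ *+ _ - _); ring.
Qed.

End TEdgeJoinMatrix.

(** * The characteristic polynomial of the join *)

Section CharPoly.
Variables (R : rcfType) (alpha : R) (G1 G2 : sgraph) (t1 t2 : nat).
Local Notation n1 := (gorder G1).
Local Notation n2 := (gorder G2).
Local Notation m1 := (gsize G1).

(** For regular factors, the eigenvalue on vectors supported on the added vertices and killed by the
    incidence matrix. *)
Definition join_edge_value : R := alpha * (2 * t1%:R + 2 + n2%:R) - 2.

(** Scalar form of the matrix [G] of [det_tedge_join_blocks], with [Aalpha] of [G1] replaced by its
    eigenvalue [lam]. *)
Definition join_quadratic (lam : R) : {poly R} :=
  'X^2 - (alpha * (t1%:R + n2%:R + 2) + t1%:R - 2 + 2 * lam) *: 'X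
  - (t1%:R * (1 - alpha) * (1 - 3 * alpha))%:P
  + ((alpha * t1%:R + lam)
      * (t1%:R - 3 + 3 * alpha + alpha * n2%:R + lam))%:P.

(** For regular factors, the characteristic polynomial of the 3 by 3 quotient matrix on vectors
    constant on V(G1), on the added vertices and on V(G2); the factor [2^-1 * t1 * n1] is [m1] by
    the handshake identity. *)
Definition join_cubic : {poly R} :=
  ('X - t2%:R%:P - (alpha * m1%:R)%:P)
     * ('X - t1%:R%:P - (alpha * t1%:R)%:P)
     * ('X + 2%:P - (2 * t1%:R)%:P - (2 * alpha)%:P - (alpha * n2%:R)%:P)
   - (2^-1 * t1%:R * n1%:R * n2%:R * (1 - alpha) ^+ 2)
       *: ('X - (alpha * t1%:R)%:P - t1%:R%:P)
   - (2 * t1%:R * (1 - alpha) ^+ 2)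
       *: ('X - t2%:R%:P - (alpha * m1%:R)%:P).

Lemma join_quadratic_neq0 lam : join_quadratic lam != 0.
Proof.
suff : (join_quadratic lam)`_2 = 1.
  by apply: contra_eq_neq => ->; rewrite coef0 eq_sym oner_neq0.
rewrite !(coefD, coefN, coefZ, coefXn, coefX, coefC) /=; ring.
Qed.

Hypotheses (reg1 : regular G1 t1) (reg2 : regular G2 t2).
Hypotheses (halpha : 0 <= alpha <= 1) (n1_gt0 : (0 < n1)%N) (n2_gt0 : (0 < n2)%N).
Local Notation A1 := (Aalpha G1 alpha).
Local Notation A2 := (Aalpha G2 alpha).

Lemma spectrum_Aalpha G t : regular G t -> (0 < gorder G)%N ->
  spectrum (Aalpha G alpha)
  = t%:R :: [seq lambda j (Aalpha G alpha) | j <- index_iota 2 (gorder G).+1].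
Proof.
move=> regG G0; apply: spectrum_cons => //; first exact: Aalpha_sym.
  exact: Aalpha_ge0.
exact: Aalpha_row_sum.
Qed.

(** Powers of the edge factor stand on both sides because [m1] may be smaller than [n1]. *)
Lemma char_poly_tedge_join :
  ('X - join_edge_value%:P) ^+ n1 * char_poly (Aalpha (tedge_join G1 G2) alpha)
  = ('X - join_edge_value%:P) ^+ m1
    * \prod_(j <- index_iota 2 n2.+1) ('X - (alpha * m1%:R + lambda j A2)%:P)
    * \prod_(i <- index_iota 2 n1.+1) join_quadratic (lambda i A1)
    * join_cubic.
Proof.
pose W : {poly R} := 'X - join_edge_value%:P.
pose d1 : {poly R} := \prod_(y <- spectrum A1) ('X - (alpha * t1%:R + y)%:P).
pose d2 : {poly R} := \prod_(y <- spectrum A2) ('X - (alpha * m1%:R + y)%:P).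
have prod_neq0 (c : R) (s : seq R) : \prod_(y <- s) ('X - (c + y)%:P) != 0.
  by elim/big_ind: _ => *; rewrite ?oner_eq0 ?mulf_neq0 ?polyXsubC_eq0.
(* Off the roots of these four factors, [w] is nonzero, [U] and [Q] are invertible, and [f], the
   value of the quadratic at [t1], is nonzero. *)
apply: (@eq_poly_cofinite _ _ _ (W * d1 * d2 * join_quadratic t1%:R)).
  by rewrite !mulf_neq0 ?prod_neq0 ?polyXsubC_eq0 ?join_quadratic_neq0.
move=> x; rewrite !hornerM !mulf_eq0 !negb_or => /andP[/andP[/andP[w0 d10] d20] f0].
have char_shift G c : (char_poly (Aalpha G alpha)).[x - c]
    = (\prod_(y <- spectrum (Aalpha G alpha)) ('X - (c + y)%:P)).[x].
  rewrite symmetric_char_poly ?Aalpha_sym // !horner_prod.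
  by apply: eq_bigr => y _; rewrite !hornerE; ring.
pose b := 1 - alpha; pose w := x - join_edge_value.
pose u := x - alpha * t1%:R - t1%:R; pose q := x - alpha * m1%:R - t2%:R.
pose k := (b - alpha) * t1%:R.
pose U := (x - alpha * t1%:R)%:M - A1; pose Q := (x - alpha * m1%:R)%:M - A2.
have Uu : U \in unitmx by rewrite unitmxE unitfE -horner_char_poly char_shift.
have Qu : Q \in unitmx by rewrite unitmxE unitfE -horner_char_poly char_shift.
have w_neq0 : w != 0 by move: w0; rewrite !hornerE.
have q_neq0 : q != 0.
  move: d20; rewrite /d2 (spectrum_Aalpha reg2) // big_cons hornerM mulf_eq0 negb_or.
  by case/andP; rewrite !hornerE opprD addrA.
have fE : (join_quadratic t1%:R).[x] = w * u - (u + b) * (2 * b * t1%:R).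
  by rewrite /join_quadratic !horner_ringE /w /u /b /join_edge_value; ring.
have Ue : U *m const_mx 1 = u *: (const_mx 1 : 'cV_(_)).
  by rewrite mulmxBl mul_scalar_mx (Aalpha_ones alpha reg1) -scalerBl.
have Qe : Q *m const_mx 1 = q *: (const_mx 1 : 'cV_(_)).
  by rewrite mulmxBl mul_scalar_mx (Aalpha_ones alpha reg2) -scalerBl.
have detG : \det (w *: U
      - (U + b%:M) *m (b *: (incidence_mx R G1 *m (incidence_mx R G1)^T)))
    = (\prod_(y <- spectrum A1) join_quadratic y).[x].
  rewrite (incidence_mul_tr reg1 alpha) horner_prod.
  have -> : w *: U - (U + b%:M) *m (A1 + ((1 - alpha - alpha) * t1%:R)%:M)
     = (w * (x - alpha * t1%:R) - (x - alpha * t1%:R + b) * k)%:M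
       + (k - w - (x - alpha * t1%:R) - b) *: A1 + 1 *: (A1 *m A1).
    rewrite /U; set v := x - _; rewrite -/b -/k.
    move: A1 => Y; rewrite mulmxDr !mulmxDl mulNmx !mul_scalar_mx mul_mx_scalar.
    move: (Y *m Y) => X; apply/matrixP => i j; rewrite !mxE.
    by case: eqP => _; rewrite ?mulr1n ?mulr0n; ring.
  rewrite symmetric_det_quadratic ?Aalpha_sym //; apply: eq_bigr => y _.
  by rewrite /join_quadratic !horner_ringE /w /k /b /join_edge_value; ring.
have detQ : \det Q = d2.[x] by rewrite -horner_char_poly char_shift.
(* The all-ones vectors contribute [q] to the determinant of [Q] and [f] to that of [G]. Cancelling
   [f * q] leaves the factors of index at least 2, together with the cubic. *)
have cancel_fq (f p2 p1 g wn wm p : R) : f != 0 ->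
    wn * (f * q) * p = wm * (q * p2) * (f * p1) * g -> wn * p = wm * p2 * p1 * g.
  move=> f_neq0 eq_fq; apply: (mulfI (mulf_neq0 f_neq0 q_neq0)).
  transitivity (wn * (f * q) * p); first by ring.
  by rewrite eq_fq; ring.
rewrite fE in f0.
have := det_tedge_join_blocks Uu Qu w_neq0 q_neq0 f0 Ue Qe
  (incidence_col_sum R G1) (incidence_row_sum R reg1).
have wE : x - alpha * (2 * t1%:R + 2 + n2%:R) + 2 = w.
  by rewrite /w /join_edge_value; ring.
have := det_tedge_join reg1 reg2 alpha x; rewrite wE -/U -/Q -/b => <-.
rewrite detG detQ card_edge_type /d2 !(spectrum_Aalpha reg1) ?(spectrum_Aalpha reg2) //.
rewrite !big_cons !big_map !hornerM !horner_exp fE.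
have -> : ('X - (alpha * m1%:R + t2%:R)%:P).[x] = q.
  by rewrite !horner_ringE opprD addrA.
have -> : ('X - join_edge_value%:P).[x] = w by rewrite !horner_ringE.
have -> : join_cubic.[x] = (w * u - (u + b) * (2 * b * t1%:R)) * q
    - 2^-1 * n1%:R * n2%:R * b ^+ 2 * t1%:R * u.
  by rewrite /join_cubic !horner_ringE /w /u /q /b /join_edge_value; ring.
exact: cancel_fq.
Qed.
End CharPoly.

(** * Reading the spectrum off the characteristic polynomial *)

Lemma proots_factorization (R : rcfType) (I : Type) (r : seq I) (s : seq R)
    (a c : {poly R}) (F : I -> {poly R}) :
  (forall i, F i != 0) ->
  let p := a * \prod_(y <- s) ('X - y%:P) * \prod_(i <- r) F i * c in
  p != 0 ->
  perm_eq (proots p) (proots a ++ s ++ flatten [seq proots (F i) | i <- r] ++ proots c).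
Proof.
move=> F0 /=; rewrite !mulf_eq0 !negb_or => /andP[/andP[/andP[a0 s0] r0] c0].
rewrite (permPl (proots_mul _ c0)) ?mulf_neq0 // !catA perm_cat2r.
rewrite (permPl (proots_mul _ r0)) ?mulf_neq0 //.
apply: perm_cat; last exact: proots_prod.
by rewrite (permPl (proots_mul a0 s0)) perm_cat2l proots_prod_XsubC.
Qed.


(** A vertex and its only neighbour form a set closed under adjacency, so by connectedness they are
    the whole graph. In case (a) this makes [G1] a single edge. *)
Lemma connected_matching_order (G : sgraph) :
  regular G 1%N -> connected G -> (0 < gorder G)%N -> gorder G = 2%N.
Proof.
move=> regG conG /card_gt0P[x _].
have [y nx] : exists y : G, [set z | adj x z] = [set y].
  by apply/cards1P; rewrite -[#|_|]/(degree x) regG.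
have xy : adj x y by have := set11 y; rewrite -nx inE.
have ny : [set z | adj y z] = [set x].
  have /eqP/cards1P[z nyz] : #|[set z | adj y z]| = 1%N by exact: regG.
  have : x \in [set z | adj y z] by rewrite inE adj_sym.
  by rewrite nyz => /set1P ->.
have adjx z : adj x z = (z == y) by move/setP/(_ z): nx; rewrite !inE.
have adjy z : adj y z = (z == x) by move/setP/(_ z): ny; rewrite !inE.
have clos : closed (@adj G) [set x; y].
  apply: intro_closed => [|a c ac]; first exact/sym_connect_sym/adj_sym.
  rewrite !inE => /orP[]/eqP ea; move: ac;
    by rewrite ea ?adjx ?adjy => ->; rewrite ?orbT.
have <- : #|[set x; y]| = 2%N by rewrite cards2 (adj_neq xy).
apply: eq_card => z; rewrite !inE; apply/esym.
by have := closed_connect clos (conG x z); rewrite !inE eqxx => <-.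
Qed.

Theorem corollary6p1 (R : rcfType) (alpha : R) (G1 G2 : sgraph)
    (t1 n1 m1 t2 n2 : nat)
    (halpha : 0 <= alpha <= 1)
    (hG1 : regular G1 t1) (hn1 : gorder G1 = n1) (hm1 : gsize G1 = m1)
    (hG2 : regular G2 t2) (hn2 : gorder G2 = n2)
    (n1_gt0 : (0 < n1)%N) (n2_gt0 : (0 < n2)%N) :
  (t1 = 1%N -> connected G1 ->
    perm_eq (spectrum (Aalpha (tedge_join G1 G2) alpha))
      ([:: 3 * alpha - 1]
       ++ [seq alpha + lambda j (Aalpha G2 alpha) | j <- index_iota 2 n2.+1]
       ++ proots
            (('X - alpha%:P - 1) * ('X - alpha%:P - t2%:R%:P)
               * ('X - (2 * alpha)%:P - (alpha * n2%:R)%:P)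
             - (n2%:R * (1 - alpha) ^+ 2) *: ('X - alpha%:P - 1)
             - (2 * (1 - alpha) ^+ 2) *: ('X - alpha%:P - t2%:R%:P))))
  /\
  ((2 <= t1)%N ->
    perm_eq (spectrum (Aalpha (tedge_join G1 G2) alpha))
      (nseq (m1 - n1) (alpha * (2 * t1%:R + 2 + n2%:R) - 2)
       ++ [seq alpha * m1%:R + lambda j (Aalpha G2 alpha)
            | j <- index_iota 2 n2.+1]
       ++ flatten
            [seq (let lam := lambda i (Aalpha G1 alpha) in
              proots
                ('X^2
                 - (alpha * (t1%:R + n2%:R + 2) + t1%:R - 2 + 2 * lam) *: 'X
                 - (t1%:R * (1 - alpha) * (1 - 3 * alpha))%:P
                 + ((alpha * t1%:R + lam)
                     * (t1%:R - 3 + 3 * alpha + alpha * n2%:R + lam))%:P))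
            | i <- index_iota 2 n1.+1]
       ++ proots
            (('X - t2%:R%:P - (alpha * m1%:R)%:P)
               * ('X - t1%:R%:P - (alpha * t1%:R)%:P)
               * ('X + 2%:P - (2 * t1%:R)%:P - (2 * alpha)%:P
                  - (alpha * n2%:R)%:P)
             - (2^-1 * t1%:R * n1%:R * n2%:R * (1 - alpha) ^+ 2)
                 *: ('X - (alpha * t1%:R)%:P - t1%:R%:P)
             - (2 * t1%:R * (1 - alpha) ^+ 2)
                 *: ('X - t2%:R%:P - (alpha * m1%:R)%:P)))).
Proof.
have main := char_poly_tedge_join hG1 hG2 halpha.
subst n1 m1 n2; have {}main := main n1_gt0 n2_gt0; have hs := handshake hG1.
set M := Aalpha _ alpha in main *.
have M0 : char_poly M != 0 by rewrite monic_neq0 ?char_poly_monic.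
pose W : {poly R} := 'X - (join_edge_value alpha G2 t1)%:P.
have W0 : W != 0 by rewrite polyXsubC_eq0.
have quad0 i : join_quadratic alpha G2 t1 (lambda i (Aalpha G1 alpha)) != 0.
  exact: join_quadratic_neq0.
split=> [t1_1 conG|t1_ge2]; rewrite perm_sort.
  subst t1; have n1E := connected_matching_order hG1 conG n1_gt0.
  have m1E : gsize G1 = 1%N by move: hs; rewrite n1E; lia.
  have iotaE : index_iota 2 (gorder G1).+1 = [:: 2%N] by rewrite n1E.
  have n1R : (gorder G1)%:R = 2 :> R by rewrite n1E.
  (* The two eigenvalues sum to the trace [2 * alpha], and the first one is 1. *)
  have lam2 : lambda 2 (Aalpha G1 alpha) = 2 * alpha - 1.
    have symA := Aalpha_sym G1 alpha.
    have := sum_spectrum n1_gt0 symA.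
    rewrite (spectrum_Aalpha halpha hG1 n1_gt0) (Aalpha_trace alpha hG1) n1R iotaE.
    rewrite /= big_cons big_seq1 mulr1 => eq_tr.
    by apply: (addrI 1); rewrite eq_tr; ring.
  (* The only quadratic factor contains [W]. With the single [W] from [m1 = 1] it cancels the
     [W ^+ 2] on the other side, leaving the root [3 * alpha - 1]. *)
  have quadE : join_quadratic alpha G2 1 (2 * alpha - 1)
      = ('X - (3 * alpha - 1)%:P) * W.
    apply: (eq_poly_cofinite (oner_neq0 _)) => x _.
    by rewrite /W /join_quadratic /join_edge_value !horner_ringE; ring.
  have cubicE : join_cubic alpha G1 G2 1 t2
      = ('X - alpha%:P - 1) * ('X - alpha%:P - t2%:R%:P)
          * ('X - (2 * alpha)%:P - (alpha * (gorder G2)%:R)%:P)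
        - ((gorder G2)%:R * (1 - alpha) ^+ 2) *: ('X - alpha%:P - 1)
        - (2 * (1 - alpha) ^+ 2) *: ('X - alpha%:P - t2%:R%:P).
    apply: (eq_poly_cofinite (oner_neq0 _)) => x _.
    by rewrite /join_cubic m1E n1R !horner_ringE; field.
  (* The empty product only gives the shape expected by [proots_factorization]. *)
  have charE : char_poly M = ('X - (3 * alpha - 1)%:P)
      * \prod_(y <- [seq alpha + lambda j (Aalpha G2 alpha)
                   | j <- index_iota 2 (gorder G2).+1])
          ('X - y%:P) * \prod_(i <- [::] : seq nat) 1 * join_cubic alpha G1 G2 1 t2.
    apply: (mulfI (expf_neq0 2 W0)).
    rewrite big_map big_nil mulr1 -{1}n1E main m1E iotaE big_seq1 lam2 quadE -/W.
    under [in LHS]eq_bigr do rewrite mulr1.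
    ring.
  rewrite charE in M0 *.
  rewrite (permPl (proots_factorization _ M0)) => [|_]; last exact: oner_neq0.
  by rewrite proots_XsubC cubicE.
(* By the handshake identity with [2 <= t1]; it makes the truncated exponent [m1 - n1] a true
   difference. *)
have le_n1m1 : (gorder G1 <= gsize G1)%N by move: hs; nia.
have charE : char_poly M = W ^+ (gsize G1 - gorder G1)
    * \prod_(y <- [seq alpha * (gsize G1)%:R + lambda j (Aalpha G2 alpha)
                 | j <- index_iota 2 (gorder G2).+1])
          ('X - y%:P)
    * \prod_(i <- index_iota 2 (gorder G1).+1)
        join_quadratic alpha G2 t1 (lambda i (Aalpha G1 alpha))
    * join_cubic alpha G1 G2 t1 t2.
  apply: (mulfI (expf_neq0 (gorder G1) W0)).
  by rewrite main big_map !mulrA -exprD subnKC.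
rewrite charE in M0 *; rewrite (permPl (proots_factorization quad0 M0)).
by rewrite perm_cat2r proots_exp_XsubC.
Qed.
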